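(* Let $\ell,s,n_1,\dots,n_\ell,k_1,\dots,k_\ell$ be positive integers with $n_i\geq 4\ell^2k_i^2s$ for $i=1,\dots,\ell$. Let $V_1,\dots,V_\ell$ be pairwise disjoint sets with $|V_i|=n_i$, and let $\mathcal{F}\subseteq \sqcup_{i=1}^\ell \binom{V_i}{k_i}$. If $\nu(\mathcal{F})\leq s$, then \[ |\mathcal{F}| \leq \max_{1\leq i\leq \ell}\left[\binom{n_i}{k_i}-\binom{n_i-s}{k_i}\right]\prod_{1\leq j\leq \ell,\ j\neq i}\binom{n_j}{k_j}. \]
   Context: For pairwise disjoint finite sets $V_1,\dots,V_\ell$ and integers $k_1,\dots,k_\ell$, the direct product $\sqcup_{i=1}^\ell \binom{V_i}{k_i}$ is the collection of all subsets $F$ of $\bigcup_{i=1}^\ell V_i$ with $|F\cap V_i|=k_i$ for every $i=1,\dots,\ell$. For a family $\mathcal{F}$ of sets, the matching number $\nu(\mathcal{F})$ is the maximum number of pairwise disjoint members of $\mathcal{F}$. *)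

(* Defs.v *)
From mathcomp Require Import all_boot.

Set Implicit Arguments.
Unset Strict Implicit.
Unset Printing Implicit Defensive.

(* The direct product of the k_i-subsets of V_i: the sets F contained in the
   union of the V_i with #|F :&: V_i| = k_i for every i. *)
Definition direct_product (T : finType) (l : nat)
    (V : 'I_l -> {set T}) (k : 'I_l -> nat) : {set {set T}} :=
  [set A : {set T} | (A \subset \bigcup_(i < l) V i)
                     && [forall i : 'I_l, #|A :&: V i| == k i]].

(* trivIset M means that distinct members of M are disjoint (trivIsetP). *)
Definition matching_number (T : finType) (F : {set {set T}}) : nat :=
  \max_(M : {set {set T}} | (M \subset F) && trivIset M) #|M|.

(* Main.v *)
From mathcomp Require Import all_boot fingroup perm zify.
Require Import Defs.

(* Induction on s. Shifting inside each part V_i changes neither the size of F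
   nor the bound on its matchings, so F may be assumed shifted. Write N for the
   size of the direct product and D(v) for the number of its members through v.

   If some v lies in more than D(v) / 4l members of F, every s-matching avoiding
   v extends through v; hence the members avoiding v have no s-matching and the
   induction hypothesis applies to them.

   Otherwise let W_i be the first s elements of V_i and m = min_i [n_i / k_i].
   The members of F meeting some W_i are few because all degrees are small. For
   v in V_i outside W_i, shiftedness lets each of the s+1 elements of W_i + v
   replace v, so the link of v in the remaining members has no (s+1)-matching;
   Katona's averaging bounds it by s D(v) / m, and covering the remaining members
   by a maximal matching bounds their number. Each class has at most s N / 4m
   members, so |F| <= s N / 2m, within the claimed bound for the i attaining m. *)

Set Implicit Arguments.
Unset Strict Implicit.
Unset Printing Implicit Defensive.

(** * Direct products and their links *)

Definition pairwise_disjoint (T : finType) (l : nat) (V : 'I_l -> {set T}) :=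
  forall i j, i != j -> [disjoint V i & V j].

Definition delete (T : finType) (l : nat) (V : 'I_l -> {set T}) (v : T) :=
  fun j => V j :\ v.

(** Together with [delete] this makes the link of [v] a direct product again. When the parts are
    disjoint only the part containing [v] changes, so one formula serves every index. *)
Definition decrease (T : finType) (l : nat) (V : 'I_l -> {set T})
    (k : 'I_l -> nat) (v : T) :=
  fun j => k j - (v \in V j).

Section DirectProduct.

Variables (T : finType) (l : nat).
Implicit Types (V : 'I_l -> {set T}) (k : 'I_l -> nat) (v : T) (A : {set T}).

Lemma pairwise_disjoint_uniq V i j v :
  pairwise_disjoint V -> v \in V i -> v \in V j -> i = j.
Proof.
move=> Vd vi vj; apply/eqP/negPn/negP => ij.
by have /disjointFr/(_ vi) := Vd _ _ ij; rewrite vj.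
Qed.

Lemma pairwise_disjoint_delete V v :
  pairwise_disjoint V -> pairwise_disjoint (delete V v).
Proof.
move=> Vd i j ij; apply: disjointWl (subsetDl _ _) _.
by apply: disjointWr (subsetDl _ _) _; apply: Vd.
Qed.

Lemma card_delete V i v : #|delete V v i| = #|V i| - (v \in V i).
Proof. by rewrite /delete (cardsD1 v (V i)); lia. Qed.

Lemma mem_direct_product V k A :
  reflect (A \subset \bigcup_(i < l) V i /\ forall i, #|A :&: V i| = k i)
          (A \in direct_product V k).
Proof.
rewrite inE; apply: (iffP andP) => -[sAV cA]; split=> //.
  by move=> i; apply/eqP; move/forallP: cA.
by apply/forallP => i; apply/eqP.
Qed.

(** A member is determined by its traces on the parts, and these can be chosen independently: [pack]
    is a bijection from tuples of traces onto the product. *)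
Lemma card_direct_product V k : pairwise_disjoint V ->
  #|direct_product V k| = \prod_(i < l) 'C(#|V i|, k i).
Proof.
move=> Vd.
pose D i := [set B : {set T} | (B \subset V i) && (#|B| == k i)].
pose pack (f : {ffun 'I_l -> {set T}}) := \bigcup_(i < l) f i.
have packI f i : f \in family D -> pack f :&: V i = f i.
  move/familyP => fD; apply/setP => x; rewrite inE; apply/andP/idP => [[]|xf].
    move/bigcupP => [j _ xf] xi.
    move: (fD j); rewrite inE => /andP[/subsetP/(_ _ xf) xj _].
    by rewrite (pairwise_disjoint_uniq Vd xi xj).
  split; first by apply/bigcupP; exists i.
  by move: (fD i); rewrite inE => /andP[/subsetP/(_ _ xf)].
have -> : direct_product V k = [set pack f | f in family D].
  apply/setP => A; apply/mem_direct_product/imsetP => [[sAV cA]|[f fD ->]].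
    exists [ffun i => A :&: V i].
      by apply/familyP => i; rewrite ffunE inE subsetIr cA /=.
    apply/setP => x; apply/idP/bigcupP => [xA|[i _]].
      have /bigcupP[i _ xi] := subsetP sAV _ xA.
      by exists i; rewrite // ffunE inE xA.
    by rewrite ffunE inE => /andP[].
  split=> [|i]; last first.
    by rewrite packI //; move/familyP: fD => /(_ i); rewrite inE => /andP[_ /eqP].
  apply/bigcupsP => i _; apply: subset_trans (bigcup_sup i _) => //.
  by move/familyP: fD => /(_ i); rewrite inE => /andP[].
rewrite card_in_imset; last first.
  by move=> f g fD gD fg; apply/ffunP => i; rewrite -packI // fg packI.
rewrite card_family foldrE big_map big_enum /=.
by apply: eq_bigr => i _; rewrite cards_draws.
Qed.

Lemma direct_product_delete V k A v :
  (A \in direct_product V k) && (v \notin A) =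
  (A \in direct_product (delete V v) k).
Proof.
have E i : v \notin A -> A :&: delete V v i = A :&: V i.
  move=> vA; apply/setP => x; rewrite !inE.
  by case: eqP => // ->; rewrite (negPf vA).
apply/andP/mem_direct_product => [[/mem_direct_product[sAV cA] vA]|[sAV cA]].
  split=> [|i]; last by rewrite E.
  apply/subsetP => x xA; have /bigcupP[i _ xi] := subsetP sAV _ xA.
  apply/bigcupP; exists i => //; rewrite !inE xi andbT.
  by apply: contraNneq vA => <-.
have vA : v \notin A.
  by apply/negP => /(subsetP sAV)/bigcupP[i _]; rewrite !inE eqxx.
split=> //; apply/mem_direct_product; split=> [|i]; last by rewrite -E.
apply: subset_trans sAV _; apply/bigcupsP => i _.
by apply: subset_trans (subsetDl _ _) _; apply: bigcup_sup.
Qed.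

Lemma direct_product_link V k A v : v \in A -> A \in direct_product V k ->
  A :\ v \in direct_product (delete V v) (decrease V k v).
Proof.
move=> vA /mem_direct_product[sAV cA]; apply/mem_direct_product; split=> [|i].
  apply/subsetP => x; rewrite !inE => /andP[xv xA].
  have /bigcupP[i _ xi] := subsetP sAV _ xA.
  by apply/bigcupP; exists i => //; rewrite !inE xv.
have -> : (A :\ v) :&: delete V v i = (A :&: V i) :\ v.
  by apply/setP => x; rewrite !inE; case: (x == v).
by rewrite /decrease -cA (cardsD1 v (A :&: V i)) inE vA /=; lia.
Qed.

(** Only the factor of the part containing [v] changes, and there n C(n-1, k-1) = k C(n, k). *)
Lemma card_direct_product_link V k i v : pairwise_disjoint V -> v \in V i ->
  0 < k i ->
  #|V i| * #|direct_product (delete V v) (decrease V k v)| =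
  k i * #|direct_product V k|.
Proof.
move=> Vd vi ki.
rewrite !card_direct_product //; last exact: pairwise_disjoint_delete.
rewrite (bigD1 i) //= [in RHS](bigD1 i) //= !mulnA card_delete /decrease vi.
rewrite !subn1 mul_bin_diag; congr (_ * _).
  by rewrite prednK.
apply: eq_bigr => j ji; rewrite card_delete.
case: (boolP (v \in V j)) => [vj|]; last by rewrite !subn0.
by rewrite (pairwise_disjoint_uniq Vd vi vj) eqxx in ji.
Qed.

Lemma card_direct_product_split V k i v : pairwise_disjoint V -> v \in V i ->
  0 < k i ->
  #|direct_product V k| = #|direct_product (delete V v) (decrease V k v)|
                          + #|direct_product (delete V v) k|.
Proof.
move=> Vd vi ki.
have Vd' := pairwise_disjoint_delete v Vd.
rewrite !card_direct_product // !(bigD1 (P := predT) i) //= card_delete.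
rewrite /decrease vi !subn1.
have -> : \prod_(j < l | j != i) 'C(#|delete V v j|, k j - (v \in V j)) =
          \prod_(j < l | j != i) 'C(#|V j|, k j).
  apply: eq_bigr => j ji; rewrite card_delete.
  case: (boolP (v \in V j)) => [vj|]; last by rewrite !subn0.
  by rewrite (pairwise_disjoint_uniq Vd vi vj) eqxx in ji.
have -> : \prod_(j < l | j != i) 'C(#|delete V v j|, k j) =
          \prod_(j < l | j != i) 'C(#|V j|, k j).
  apply: eq_bigr => j ji; rewrite card_delete.
  case: (boolP (v \in V j)) => [vj|]; last by rewrite !subn0.
  by rewrite (pairwise_disjoint_uniq Vd vi vj) eqxx in ji.
have : 0 < #|V i| by rewrite (cardsD1 v) vi.
by case: #|V i| => // n _; case: (k i) ki => // m _; rewrite binS mulnDl addnC.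
Qed.

Lemma link_injective v (H : {set {set T}}) :
  (forall A, A \in H -> v \in A) ->
  {in H &, injective (fun A => A :\ v)}.
Proof. by move=> vH A B /vH vA /vH vB /= E; rewrite -(setD1K vA) E setD1K. Qed.

Lemma card_link_le V k v (H : {set {set T}}) :
  H \subset direct_product V k -> (forall A, A \in H -> v \in A) ->
  #|H| <= #|direct_product (delete V v) (decrease V k v)|.
Proof.
move=> sH vH; rewrite -(card_in_imset (link_injective vH)).
apply/subset_leq_card/subsetP => _ /imsetP[A AH ->].
by apply: direct_product_link; [apply: vH | apply: (subsetP sH)].
Qed.

Lemma degree_le V k i v (H : {set {set T}}) : pairwise_disjoint V ->
  v \in V i -> H \subset direct_product V k -> (forall A, A \in H -> v \in A) ->
  #|V i| * #|H| <= k i * #|direct_product V k|.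
Proof.
(* Size 0 can occur when the lemma is applied to a link; then no member contains [v] and [H] is
   empty. *)
move=> Vd vi sH vH; case: (posnP (k i)) => [ki0|ki].
  suff -> : H = set0 by rewrite cards0 muln0.
  apply/setP => A; rewrite inE; apply/negP => AH.
  have /mem_direct_product[_ /(_ i)] := subsetP sH _ AH.
  by move/eqP; rewrite ki0 cards_eq0 => /eqP/setP/(_ v); rewrite !inE vi vH.
by rewrite -(card_direct_product_link Vd vi ki) leq_mul2l card_link_le ?orbT.
Qed.

Lemma codegree_le V k i j u v (H : {set {set T}}) : pairwise_disjoint V ->
  v \in V i -> 0 < k i -> u \in V j -> u != v ->
  H \subset direct_product V k ->
  (forall A, A \in H -> (v \in A) && (u \in A)) ->
  #|V j| * #|H| <= k j * #|direct_product (delete V v) (decrease V k v)|.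
Proof.
move=> Vd vi ki uj uv sH uvH.
have vH A : A \in H -> v \in A by move=> /uvH/andP[].
have sL : [set A :\ v | A in H] \subset
          direct_product (delete V v) (decrease V k v).
  apply/subsetP => _ /imsetP[A AH ->].
  by apply: direct_product_link; [apply: vH | apply: (subsetP sH)].
have uL A : A \in [set A :\ v | A in H] -> u \in A.
  by case/imsetP => B /uvH/andP[_ uB] ->; rewrite !inE uv.
have uj' : u \in delete V v j by rewrite !inE uv.
have := degree_le (pairwise_disjoint_delete v Vd) uj' sL uL.
(* This serves the case of [u] and [v] in one part of size n: the link of [v], of size d, gives
   (n-1)|H| <= (k-1)d, and adding |H| <= d gives n|H| <= k d. *)
have := card_link_le sH vH.
rewrite (card_in_imset (link_injective vH)) card_delete /decrease.
case: (boolP (v \in V j)) => [vj|_]; last by rewrite !subn0.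
have <- := pairwise_disjoint_uniq Vd vi vj; move: ki (#|direct_product _ _|).
have : 0 < #|V i| by rewrite (cardsD1 v) vi.
by case: #|V i| (k i) => // n [] // m _ _ d /=; rewrite !subn1 /=; nia.
Qed.

End DirectProduct.

(** * Matchings and averaging *)

(* The sets are compared by index: unlike for [trivIset], repeating the empty
   set is allowed, as is needed for links of singletons. *)
Definition has_matching (T : finType) (F : {set {set T}}) (t : nat) :=
  exists B : nat -> {set T},
    (forall a, a < t -> B a \in F) /\
    (forall a b, a < t -> b < t -> a != b -> [disjoint B a & B b]).

Section Matchings.

Variables (T : finType) (l : nat).
Implicit Types (V : 'I_l -> {set T}) (k : 'I_l -> nat) (F : {set {set T}}).

Lemma has_matching_sub F F' t :
  F \subset F' -> has_matching F t -> has_matching F' t.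
Proof.
by move=> sF [B [BF Bd]]; exists B; split=> // a ta; apply: (subsetP sF); apply: BF.
Qed.

Lemma has_matching_cons F t A (B : nat -> {set T}) : A \in F ->
  (forall a, a < t -> B a \in F) ->
  (forall a b, a < t -> b < t -> a != b -> [disjoint B a & B b]) ->
  (forall a, a < t -> [disjoint A & B a]) -> has_matching F t.+1.
Proof.
move=> AF BF Bd AB; exists (fun a => if a == t then A else B a); split.
  by move=> a; case: eqP => // ne lt_a; apply: BF; lia.
move=> a b lt_a lt_b ab; case: eqP => [at_|ne]; case: eqP => [bt|ne'].
- by rewrite at_ bt eqxx in ab.
- by apply: AB; lia.
- by rewrite disjoint_sym; apply: AB; lia.
- by apply: Bd => //; lia.
Qed.

Lemma card_matching_union V k (B : nat -> {set T}) t i :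
  (forall a, a < t -> B a \in direct_product V k) ->
  #|(\bigcup_(a < t) B a) :&: V i| <= t * k i.
Proof.
move=> BF; elim: t BF => [|t IH] BF; first by rewrite big_ord0 set0I cards0.
rewrite big_ord_recr /= setIUl mulSn addnC.
apply: leq_trans (leq_card_setU _ _) _; apply: leq_add.
  by apply: IH => a ta; apply: BF; lia.
by have /mem_direct_product[_ ->] := BF t (ltnSn t).
Qed.

(** Union bound over the vertices of a hitting set: the at most [e i] vertices of [U] in [V i]
    account together for at most X / r members, and there are [l] parts. *)
Lemma hitting_le V (e : 'I_l -> nat) (r X : nat) (U : {set T}) F :
  U \subset \bigcup_(i < l) V i -> (forall i, #|U :&: V i| <= e i) ->
  (forall A, A \in F -> ~~ [disjoint A & U]) ->
  (forall i u, u \in U -> u \in V i ->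
     r * e i * #|[set A in F | u \in A]| <= X) ->
  r * #|F| <= l * X.
Proof.
move=> sU cU hF degX.
have: r * #|F| <= r * \sum_(A in F) \sum_(i < l) \sum_(u in U :&: V i) (u \in A).
  rewrite leq_mul2l -sum1_card; apply/orP; right.
  apply: leq_sum => A /hF; rewrite -setI_eq0 => /set0Pn[u]; rewrite inE => /andP[uA uU].
  have /bigcupP[i _ ui] := subsetP sU _ uU.
  rewrite (bigD1 i) //= (bigD1 u) /=; last by rewrite inE uU.
  by rewrite uA; lia.
move/leq_trans; apply.
rewrite exchange_big big_distrr /= -[X in _ <= X * _]card_ord -sum_nat_const.
apply: leq_sum => i _; rewrite exchange_big /=.
have -> : \sum_(u in U :&: V i) \sum_(A in F) (u \in A) =
          \sum_(u in U :&: V i) #|[set A in F | u \in A]|.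
  apply: eq_bigr => u _; rewrite -sum1_card [RHS]big_mkcond [LHS]big_mkcond /=.
  by apply: eq_bigr => A _; rewrite inE; case: (A \in F); case: (u \in A).
case: (posnP (e i)) => [e0|e_gt0].
  rewrite big1 ?muln0 // => u uU; have := cU i.
  by rewrite e0 leqn0 cards_eq0 => /eqP E; rewrite E inE in uU.
rewrite -(leq_pmul2l e_gt0) mulnA [e i * r]mulnC big_distrr /=.
apply: (@leq_trans (\sum_(u in U :&: V i) X)).
  by apply: leq_sum => u; rewrite inE => /andP[uU ui]; apply: degX.
by rewrite sum_nat_const leq_mul2r cU orbT.
Qed.

(** * Part-preserving permutations and averaging over them *)

Definition part_perm V (p : {perm T}) :=
  [forall i, forall x, (p x \in V i) == (x \in V i)].

Lemma part_permP V (p : {perm T}) :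
  reflect (forall i x, (p x \in V i) = (x \in V i)) (part_perm V p).
Proof.
by apply: (iffP 'forall_forallP) => h i x; apply/eqP; rewrite h.
Qed.

Lemma part_permM V (p q : {perm T}) :
  part_perm V p -> part_perm V q -> part_perm V (p * q)%g.
Proof.
by move=> /part_permP hp /part_permP hq; apply/part_permP => i x; rewrite permM hq hp.
Qed.

Lemma part_perm_direct_product V k (p : {perm T}) A : part_perm V p ->
  A \in direct_product V k -> p @: A \in direct_product V k.
Proof.
move=> /part_permP hp /mem_direct_product[sA cA]; apply/mem_direct_product; split.
  apply/subsetP => _ /imsetP[x xA ->]; have /bigcupP[i _ xi] := subsetP sA _ xA.
  by apply/bigcupP; exists i; rewrite // hp.
move=> i; rewrite -cA -[RHS](card_imset _ (@perm_inj _ p)); apply: eq_card => y.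
rewrite in_setI; apply/andP/imsetP => [[/imsetP[x xA ->]]|[x]].
  by rewrite hp => xi; exists x; rewrite // inE xA.
by rewrite inE => /andP[xA xi] ->; rewrite hp xi imset_f.
Qed.

(** Equal traces sizes mean that any x in A \ E has a partner y in E \ A in the same part;
    transposing them decreases |A \ E|. *)
Lemma part_perm_transitive V k A E : pairwise_disjoint V ->
  A \in direct_product V k -> E \in direct_product V k ->
  exists2 p : {perm T}, part_perm V p & p @: A = E.
Proof.
move=> Vd; have [n] := ubnP #|A :\: E|; elim: n A => // n IH A lt_n AD ED.
have [/mem_direct_product[sA cA] /mem_direct_product[sE cE]] := (AD, ED).
have [/eqP|[x]] := set_0Vmem (A :\: E).
  rewrite setD_eq0 => sAE; exists 1%g.
    by apply/part_permP => i x; rewrite perm1.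
  have -> : (1%g : {perm T}) @: A = A.
    by rewrite (eq_imset (g := id)) ?imset_id // => x; rewrite perm1.
  apply/eqP; rewrite eqEsubset sAE; apply/subsetP => y yE.
  have /bigcupP[i _ yi] := subsetP sE _ yE.
  have : A :&: V i == E :&: V i by rewrite eqEcard setSI // cA cE leqnn.
  by move/eqP/setP/(_ y); rewrite !inE yE yi !andbT.
rewrite inE => /andP[xE xA]; have /bigcupP[i _ xi] := subsetP sA _ xA.
have [y] : exists y, y \in (E :&: V i) :\: A.
  apply/set0Pn; rewrite setD_eq0; apply: contra xE => sEA.
  have : E :&: V i == A :&: V i.
    by rewrite eqEcard cA cE leqnn andbT subsetI sEA subsetIr.
  by move/eqP/setP/(_ x); rewrite !inE xA xi !andbT => ->.
rewrite !inE => /and3P[yA yE yi].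
have tP : part_perm V (tperm x y).
  have xyV j : (x \in V j) = (y \in V j).
    by apply/idP/idP => /(pairwise_disjoint_uniq Vd _) E0;
      rewrite -?(E0 _ xi) -?(E0 _ yi).
  by apply/part_permP => j z; case: tpermP => [->|->|] //; rewrite xyV.
have [|p hp <-] := IH (tperm x y @: A) _ (part_perm_direct_product tP AD) ED.
  rewrite -ltnS; apply: leq_trans lt_n; rewrite ltnS.
  apply: (@leq_ltn_trans #|(A :\: E) :\ x|).
    apply/subset_leq_card/subsetP => z; rewrite !inE => /andP[zE].
    case/imsetP => w wA; case: tpermP => [_ zy|wy|wx _ zw].
    - by rewrite zy yE in zE.
    - by rewrite -wy wA in yA.
    - by rewrite -zw in wA wx; rewrite zE wA !andbT; apply/eqP.
  by rewrite [X in _ < X](cardsD1 x) !inE xE xA.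
exists (tperm x y * p)%g; first exact: part_permM.
by rewrite -imset_comp; apply: eq_imset => z; rewrite permM.
Qed.

Lemma blocks_exist V k m : pairwise_disjoint V ->
  (forall i, m * k i <= #|V i|) ->
  exists B : nat -> {set T}, (forall b, b < m -> B b \in direct_product V k) /\
    (forall a b, a != b -> [disjoint B a & B b]).
Proof.
move=> Vd mk.
(* Each part is cut into consecutive segments of length [k i]; block b collects the b-th segment of
   every part. *)
pose S i b := [set x in take (b * k i) (enum (V i))].
have S_mono i a b : a <= b -> S i a \subset S i b.
  move=> ab; apply/subsetP => x; rewrite !inE.
  by rewrite -(@take_takel _ (a * k i) (b * k i)) ?leq_mul2r ?ab ?orbT // => /mem_take.
have S_V i b : S i b \subset V i.
  by apply/subsetP => x; rewrite inE => /mem_take; rewrite mem_enum.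
have cS i b : b <= m -> #|S i b| = b * k i.
  move=> bm; rewrite cardsE (card_uniqP _) ?take_uniq ?enum_uniq //.
  rewrite size_takel // -cardE; apply: leq_trans (mk i).
  by rewrite leq_mul2r bm orbT.
have BV i j b x : x \in S j b.+1 :\: S j b -> x \in V i -> i = j.
  rewrite inE => /andP[_ /(subsetP (S_V _ _)) xj] xi.
  exact: pairwise_disjoint_uniq Vd xi xj.
exists (fun b => \bigcup_(i < l) (S i b.+1 :\: S i b)); split.
  move=> b bm; apply/mem_direct_product; split.
    apply/bigcupsP => i _; apply: subset_trans (bigcup_sup i _) => //.
    by apply: subset_trans (subsetDl _ _) _.
  move=> i; have -> : (\bigcup_(i < l) (S i b.+1 :\: S i b)) :&: V i = S i b.+1 :\: S i b.
    apply/setP => x; rewrite inE; apply/andP/idP => [[/bigcupP[j _ xj] xi]|xS].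
      by rewrite (BV _ _ _ _ xj xi).
    split; first by apply/bigcupP; exists i.
    by move: xS; rewrite inE => /andP[_ /(subsetP (S_V _ _))].
  rewrite cardsD (setIidPr _) ?S_mono // !cS //; last exact: ltnW.
  by rewrite mulSn addnK.
move=> a b; wlog ab : a b / a < b => [H|_].
  by rewrite neq_ltn => /orP[|] ab; [|rewrite disjoint_sym]; apply: H; rewrite // neq_ltn ab ?orbT.
rewrite -setI_eq0; apply/eqP/setP => x; rewrite !inE; apply/negP => /andP[].
case/bigcupP => i _ xi /bigcupP[j _ xj].
have xV : x \in V i by move: xi; rewrite inE => /andP[_ /(subsetP (S_V _ _))].
have E := BV _ _ _ _ xj xV; rewrite -{}E in xj.
move: xi xj; rewrite !in_setD => /andP[_ xa] /andP[xb _].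
by rewrite (subsetP (S_mono i _ _ ab) _ xa) in xb.
Qed.

(* Katona's averaging: a random part-preserving permutation makes each of [m]
   fixed disjoint blocks uniform in the direct product, while at most [s] of the
   blocks can land in [G]. *)
Lemma katona_averaging V k m s (G : {set {set T}}) : pairwise_disjoint V ->
  (forall i, m * k i <= #|V i|) -> G \subset direct_product V k ->
  ~ has_matching G s.+1 -> m * #|G| <= s * #|direct_product V k|.
Proof.
move=> Vd mk sG nG; have [B [BD Bd]] := blocks_exist Vd mk.
set N := direct_product V k; pose P := [set p : {perm T} | part_perm V p].
have P_gt0 : 0 < #|P|.
  apply/card_gt0P; exists 1%g; rewrite inE; apply/part_permP => i x.
  by rewrite perm1.
(* By transitivity, composing with a permutation that carries [E1] to [E2] shows that [c b E] does
   not depend on E, so it equals |P| / |N|. *)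
pose c b E := #|[set p in P | p @: B b == E]|.
have c_const b E : b < m -> E \in N -> #|N| * c b E = #|P|.
  move=> bm EN; have c_le E1 E2 : E1 \in N -> E2 \in N -> c b E1 <= c b E2.
    move=> N1 N2; have [q hq qE] := part_perm_transitive Vd N1 N2.
    rewrite /c -(card_imset _ (mulIg q)); apply/subset_leq_card/subsetP => _ /imsetP[p + ->].
     rewrite !inE => /andP[hp /eqP pE].
    rewrite part_permM //= -qE -pE -imset_comp; apply/eqP.
    by apply: eq_imset => x; rewrite permM.
  rewrite -sum_nat_const -[RHS]sum1_card.
  rewrite (partition_big (fun p : {perm T} => p @: B b) (mem N)) /=; last first.
    by move=> p; rewrite inE => hp; apply: part_perm_direct_product => //; apply: BD.
  apply: eq_bigr => E' EN'; rewrite sum1_card.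
  transitivity (c b E'); first by apply/eqP; rewrite eqn_leq !c_le.
  by rewrite /c; apply: eq_card => p; rewrite [RHS]unfold_in !inE.
have few p : p \in P -> \sum_(b < m) (p @: B b \in G) <= s.
  move=> pP; rewrite leqNgt; apply/negP => lt_s; apply: nG.
  pose L := [seq b <- iota 0 m | p @: B b \in G].
  have sizeL : s < size L.
    apply: leq_trans lt_s _; rewrite size_filter -sum1_count [X in _ <= X]big_mkcond /=.
    have -> : iota 0 m = index_iota 0 m by rewrite /index_iota subn0.
    rewrite big_mkord.
    by apply: leq_sum => b _; case: ifP.
  have Lnth a : a < s.+1 -> nth 0 L a \in L.
    by move=> lt_a; apply: mem_nth; apply: leq_ltn_trans sizeL.
  exists (fun a => p @: B (nth 0 L a)); split.
    by move=> a /Lnth; rewrite mem_filter => /andP[].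
  move=> a b lt_a lt_b ab; rewrite imset_disjoint; last exact: perm_inj.
  apply: Bd; rewrite nth_uniq ?(leq_ltn_trans _ sizeL) //.
  by rewrite filter_uniq ?iota_uniq.
(* Double counting of the pairs (p, b) with p(B b) in [G]: [few] bounds them by s|P|, while
   [c_const] gives m|G||P| / |N|. *)
rewrite -(leq_pmul2r P_gt0).
apply: (@leq_trans (#|N| * \sum_(p in P) \sum_(b < m) (p @: B b \in G))); last first.
  rewrite -mulnA [s * _]mulnC -mulnA leq_mul2l; apply/orP; right.
  by rewrite -sum_nat_const; apply: leq_sum.
rewrite exchange_big /= big_distrr /=.
rewrite -{1}[m]card_ord -sum_nat_const big_distrl /=; apply: leq_sum => b _.
rewrite -sum_nat_const.
have -> : \sum_(p in P) (p @: B b \in G) = \sum_(E in G) c b E.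
  rewrite -big_mkcondr /= (partition_big (fun p : {perm T} => p @: B b) (mem G)) /=; last first.
    by move=> p /andP[].
  apply: eq_bigr => E EG; rewrite sum1_card; apply: eq_card => p.
  rewrite [LHS]unfold_in [RHS]inE; case: eqP => [->|_]; last by rewrite !andbF.
  by rewrite EG !andbT.
rewrite big_distrr /= leq_eqVlt; apply/orP; left; apply/eqP.
by apply: eq_bigr => E EG; rewrite c_const // (subsetP sG).
Qed.

End Matchings.

(** * Shifting *)

Section Shifting.

Variables (T : finType) (l : nat) (w : T -> nat).
Implicit Types (V : 'I_l -> {set T}) (k : 'I_l -> nat) (F : {set {set T}}).
Implicit Types (x y : T) (A : {set T}).

(** The order on vertices is supplied by [w]. Replacing y by x is written as a transposition, hence
    an involution that preserves disjointness. *)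
Definition shifted V F := forall i x y A, x \in V i -> y \in V i -> w x < w y ->
  A \in F -> y \in A -> x \notin A -> tperm x y @: A \in F.

(** The termination measure of the shifting process. *)
Definition weight F := \sum_(A in F) \sum_(z in A) w z.

Lemma tperm_imsetK x y : involutive (fun A => tperm x y @: A).
Proof.
move=> A; rewrite -imset_comp (eq_imset (g := id)) ?imset_id // => z /=.
exact: tpermK.
Qed.

Lemma tperm_imset_id x y A : x \notin A -> y \notin A -> tperm x y @: A = A.
Proof.
move=> xA yA; rewrite -[RHS]imset_id; apply: eq_in_imset => z zA.
by apply: tpermD; [apply: contraNneq xA | apply: contraNneq yA] => ->.
Qed.

Lemma tperm_imset_exchange x y A : y \in A -> x \notin A ->
  tperm x y @: A = x |: (A :\ y).
Proof.
move=> yA xA; rewrite -{1}(setD1K yA) imsetU1 tpermR tperm_imset_id //.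
  by rewrite !inE negb_and xA orbT.
by rewrite !inE eqxx.
Qed.

Lemma tperm_direct_product V k i x y A : pairwise_disjoint V ->
  x \in V i -> y \in V i -> A \in direct_product V k ->
  tperm x y @: A \in direct_product V k.
Proof.
move=> Vd xi yi; apply: part_perm_direct_product; apply/part_permP => j z.
have xyV : (x \in V j) = (y \in V j).
  by apply/idP/idP => /(pairwise_disjoint_uniq Vd _) E0;
    rewrite -?(E0 _ xi) -?(E0 _ yi).
by case: tpermP => [->|->|] //; rewrite xyV.
Qed.

(** The (x, y)-shift moves simultaneously all members with y and without x whose image is not yet in
    [F]; [A0] witnesses that the weight drops strictly. *)
Lemma shift_step V k F i x y A0 : pairwise_disjoint V ->
  F \subset direct_product V k -> x \in V i -> y \in V i -> w x < w y ->
  A0 \in F -> y \in A0 -> x \notin A0 -> tperm x y @: A0 \notin F ->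
  exists F', [/\ F' \subset direct_product V k, #|F'| = #|F|,
    (forall t, has_matching F' t -> has_matching F t) & weight F' < weight F].
Proof.
move=> Vd sF xi yi xy A0F yA0 xA0 shA0.
pose sh A := tperm x y @: A.
pose bad A := [&& y \in A, x \notin A & sh A \notin F].
pose phi A := if bad A then sh A else A.
have shK : involutive sh by apply: tperm_imsetK.
have xsh A : y \in A -> x \in sh A.
  by move=> yA; apply/imsetP; exists y; rewrite ?tpermR.
have phi_inj : {in F &, injective phi}.
  move=> A B AF BF; rewrite /phi; case: ifP => [/and3P[_ _ hA]|_];
    case: ifP => [/and3P[_ _ hB]|_] //; first exact: (can_inj shK).
    by move=> E; rewrite E BF in hA.
  by move=> E; rewrite -E AF in hB.
exists (phi @: F); split.
- apply/subsetP => _ /imsetP[A AF ->]; have AD := subsetP sF _ AF.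
  by rewrite /phi; case: ifP => // _; apply: tperm_direct_product Vd xi yi AD.
- exact: card_in_imset.
(* Every new set contains x, so a matching has at most one. If there is one, the transposition is
   applied to the whole matching: the new set returns to [F], an old set avoiding y is fixed, and an
   old set containing y was left in place because its image is in [F]. *)
- move=> t [B [BF Bd]].
  have [allF|] := boolP [forall a : 'I_t, B a \in F].
    exists B; split=> // a lt_a; exact: (forallP allF (Ordinal lt_a)).
  rewrite negb_forall => /existsP[[a0 lt_a0] /= Ba0].
  have good a : a < t -> B a \in F -> ~~ bad (B a).
    move=> lt_a BaF; have /imsetP[C CF E] := BF a lt_a; move: E; rewrite /phi.
    by case: ifP => [/and3P[_ _ /negP hC] E|/negbT hC ->] //; rewrite E in BaF.
  have new a : a < t -> B a \notin F -> x \in B a /\ sh (B a) \in F.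
    move=> lt_a; have /imsetP[C CF ->] := BF a lt_a; rewrite /phi.
    case: ifP => [/and3P[yC _ _] _|_]; last by rewrite CF.
    by rewrite shK; split=> //; apply: xsh.
  exists (fun a => sh (B a)); split; last first.
    move=> a b lt_a lt_b ab; rewrite imset_disjoint; last exact: perm_inj.
    exact: Bd.
  move=> a lt_a; have [xB0 shB0] := new _ lt_a0 Ba0.
  have [->//|ne] := eqVneq a a0.
  have xBa : x \notin B a by rewrite (disjointFl (Bd _ _ lt_a lt_a0 ne)).
  have BaF : B a \in F.
    by apply: contraNT xBa => BaF; have [] := new _ lt_a BaF.
  have [yBa|yBa] := boolP (y \in B a); last by rewrite /sh tperm_imset_id.
  by have := good _ lt_a BaF; rewrite /bad yBa xBa /= negbK.
- rewrite /weight big_imset //= [X in X < _](bigD1 A0) // [X in _ < X](bigD1 A0) //=.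
  have sh_lt A : y \in A -> x \notin A ->
      \sum_(z in sh A) w z < \sum_(z in A) w z.
    move=> yA xA; rewrite /sh tperm_imset_exchange // big_setU1; last first.
      by rewrite !inE negb_and xA orbT.
    by rewrite (big_setD1 y yA) /= ltn_add2r.
  rewrite -addSn; apply: leq_add.
    by rewrite /phi /bad yA0 xA0 shA0; apply: sh_lt.
  apply: leq_sum => A _; rewrite /phi; case: ifP => // /and3P[yA xA _].
  exact/ltnW/sh_lt.
Qed.

Lemma shifted_exists V k F : pairwise_disjoint V ->
  F \subset direct_product V k ->
  exists F', [/\ F' \subset direct_product V k, #|F'| = #|F|,
    (forall t, has_matching F' t -> has_matching F t) & shifted V F'].
Proof.
move=> Vd; have [n] := ubnP (weight F); elim: n F => // n IH F lt_n sF.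
pose unshifted (i : 'I_l) x y A := [&& x \in V i, y \in V i, w x < w y & A \in F] &&
  [&& y \in A, x \notin A & tperm x y @: A \notin F].
have [|no] := boolP [exists i, exists x, exists y, exists A, unshifted i x y A].
  case/existsP => i /existsP[x /existsP[y /existsP[A]]].
  case/andP => /and4P[xi yi xy AF] /and3P[yA xA shA].
  have [F1 [sF1 cF1 mF1 wF1]] := shift_step Vd sF xi yi xy AF yA xA shA.
  have [|F2 [sF2 cF2 mF2 hF2]] := IH F1 _ sF1; first exact: leq_trans wF1 _.
  by exists F2; split=> //; [rewrite cF2 | move=> t /mF2/mF1].
exists F; split=> // i x y A xi yi xy AF yA xA; apply: contraNT no => shA.
apply/existsP; exists i; apply/existsP; exists x; apply/existsP; exists y.
by apply/existsP; exists A; rewrite /unshifted xi yi xy AF yA xA.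
Qed.

Lemma initial_segment (S : {set T}) s : injective w -> s <= #|S| ->
  exists W : {set T}, [/\ W \subset S, #|W| = s &
    forall x y, x \in W -> y \in S -> y \notin W -> w x < w y].
Proof.
move=> w_inj; elim: s => [_|s IH lt_s].
  by exists set0; split; rewrite ?sub0set ?cards0 // => x y; rewrite inE.
have [W [sW cW ltW]] := IH (ltnW lt_s).
have [z0 z0S] : exists z, z \in S :\: W.
  by apply/set0Pn; rewrite -card_gt0 cardsD (setIidPr sW) cW subn_gt0.
case: (arg_minnP (P := mem (S :\: W)) w z0S) => z zSW z_min.
have [zW zS] : z \notin W /\ z \in S by move: zSW; rewrite !inE => /andP[].
exists (z |: W); split.
- by rewrite subUset sub1set zS.
- by rewrite cardsU1 zW cW.
move=> x y; rewrite !inE negb_or => /orP[/eqP->|xW] yS /andP[yz yW].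
  have := z_min y; rewrite /= !inE yW yS => /(_ isT).
  by rewrite leq_eqVlt => /orP[/eqP/w_inj E|//]; rewrite E eqxx in yz.
exact: ltW.
Qed.

End Shifting.

(** * Binomial estimates *)

(* Bernoulli: [(1 - k/n)^s <= 1 / (1 + s k / n)], cleared of denominators. *)
Lemma bin_sub_le n k s : 'C(n - s, k) * (n + s * k) <= n * 'C(n, k).
Proof.
elim: s => [|s IH]; first by rewrite subn0 addn0 mulnC.
rewrite subnS; case: (posnP (n - s)) => [E|N_gt0].
  by rewrite E; case: k {IH} => [|k]; rewrite ?bin0n // !bin0 !muln0 addn0 mul1n muln1.
rewrite -(leq_pmul2l N_gt0).
apply: (@leq_trans ((n - s) * ('C(n - s, k) * (n + s * k)))); last first.
  by rewrite leq_mul2l IH orbT.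
rewrite mulnA mul_bin_down; have : n - s <= n by apply: leq_subr.
move: (n - s) 'C(_, k) => N x Nn.
(* It remains to compare (N-k)(n+(s+1)k) with N(n+sk); for N > k the latter exceeds the former by
   k(n+(s+1)k-N), and N <= n. *)
have -> : (N - k) * x * (n + s.+1 * k) = x * ((N - k) * (n + s.+1 * k)) by lia.
rewrite [X in _ <= X]mulnCA leq_mul2l; apply/orP; right.
case: (leqP N k) => [Nk|kN]; first by have -> : N - k = 0 by lia.
nia.
Qed.

(** For use when one vertex is deleted from a part of size a but the bound for the rest is attained
    at another part, of size b. Since C(n-1, k) / C(n, k) = 1 - k/n, the first alternative amounts
    to p/a <= q/(b-s); otherwise the s removals are transferred one by one to the first part. *)
Lemma bin_exchange a b p q s : s < a -> s < b ->
  'C(b - s.+1, q) * 'C(a, p) <= 'C(b - s, q) * 'C(a.-1, p) \/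
  'C(b, q) * 'C(a - s.+1, p) <= 'C(b - s, q) * 'C(a.-1, p).
Proof.
move=> sa sb; case: (leqP (p * (b - s)) (q * a)) => [le_pq|lt_pq]; [left|right].
  have b_gt0 : 0 < b - s by lia.
  have a_gt0 : 0 < a by lia.
  rewrite -(leq_pmul2l b_gt0) -(leq_pmul2l a_gt0).
  have := mul_bin_down a p; have := mul_bin_down (b - s) q.
  rewrite -subnS; move: (b - s) b_gt0 le_pq => c c_gt0 le_pq.
  move: 'C(_, q) 'C(c, q) 'C(a.-1, p) 'C(a, p) => x y z t E1 E2.
  have -> : a * (c * (x * t)) = ((c - q) * a) * (y * t).
    by transitivity (a * t * (c * x)); [|rewrite E1]; lia.
  have -> : a * (c * (y * z)) = ((a - p) * c) * (y * t).
    by transitivity (c * y * (a * z)); [|rewrite E2]; lia.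
  by rewrite leq_mul2r; apply/orP; right; nia.
suff H r : r <= s -> 'C(b, q) * 'C(a.-1 - r, p) <= 'C(b - r, q) * 'C(a.-1, p).
  by have := H s (leqnn s); have -> : a.-1 - s = a - s.+1 by lia.
elim: r => [|r IH] rs; first by rewrite !subn0.
have {}IH := IH (ltnW rs).
have c_gt0 : 0 < b - r by lia.
have d_gt0 : 0 < a.-1 - r by lia.
have le_qp : q * (a.-1 - r) <= p * (b - r) by nia.
rewrite !subnS -(leq_pmul2l c_gt0) -(leq_pmul2l d_gt0).
have := mul_bin_down (a.-1 - r) p; have := mul_bin_down (b - r) q.
move: IH c_gt0 d_gt0 le_qp; move: (b - r) (a.-1 - r) => c d.
move: 'C(c.-1, q) 'C(c, q) 'C(d.-1, p) 'C(d, p) 'C(b, q) 'C(a.-1, p).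
move=> x y z t u v IH c_gt0 d_gt0 le_qp E1 E2.
have -> : d * (c * (u * z)) = ((d - p) * c) * (u * t).
  by transitivity (c * u * (d * z)); [|rewrite E2]; lia.
have -> : d * (c * (x * v)) = ((c - q) * d) * (y * v).
  by transitivity (d * v * (c * x)); [|rewrite E1]; lia.
by apply: leq_mul => //; nia.
Qed.

(** Subtraction-free form of C(n, k) - C(n-s, k) >= (s / 2m) C(n, k). By [bin_sub_le] the left side
    is at least the fraction sk / (n + sk) of C(n, k). *)
Lemma bin_missing_ge n k s m : 2 <= m -> 0 < k -> n < m.+1 * k ->
  4 * (s * k) <= n ->
  s * 'C(n, k) + 2 * m * 'C(n - s, k) <= 2 * m * 'C(n, k).
Proof.
move=> m2 k_gt0 nm sk; case: (posnP s) => [->|s_gt0].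
  by rewrite subn0 mul0n add0n.
have := bin_sub_le n k s; move: 'C(n - s, k) 'C(n, k) => x y xy.
have d_gt0 : 0 < n + s * k by nia.
rewrite -(leq_pmul2r d_gt0) mulnDl -[2 * m * x * _]mulnA.
(* Indeed n + sk <= 5n/4 < 5(m+1)k/4 <= 2mk, the last step using m >= 2. *)
have h : s * (n + s * k) <= 2 * m * (s * k) by nia.
apply: (@leq_trans (y * (2 * m * (s * k)) + 2 * m * (n * y))); last by nia.
apply: leq_add; last by rewrite leq_mul2l xy orbT.
by rewrite mulnAC mulnC leq_mul2l h orbT.
Qed.

(** * Vertices of large and small degree *)

Section MainInduction.

Variables (T : finType) (l : nat).
Implicit Types (V : 'I_l -> {set T}) (k : 'I_l -> nat) (F : {set {set T}}).

(** Greedy extension of the empty matching must stop with at most s members, and then their union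
    meets every member of [F]. *)
Lemma hitting_union F s : ~ has_matching F s.+1 ->
  exists t (B : nat -> {set T}), [/\ t <= s, forall a, a < t -> B a \in F &
    forall A, A \in F -> ~~ [disjoint A & \bigcup_(a < t) B a]].
Proof.
suff : has_matching F s.+1 \/ exists t (B : nat -> {set T}),
    [/\ t <= s, forall a, a < t -> B a \in F &
    forall A, A \in F -> ~~ [disjoint A & \bigcup_(a < t) B a]] by case.
have step t : has_matching F t -> has_matching F t.+1 \/ exists (B : nat -> {set T}),
    (forall a, a < t -> B a \in F) /\
    (forall A, A \in F -> ~~ [disjoint A & \bigcup_(a < t) B a]).
  move=> [B [BF Bd]].
  case: (boolP [exists A in F, [disjoint A & \bigcup_(a < t) B a]]).
    case/existsP => A /andP[AF dA]; left; apply: (has_matching_cons AF BF Bd).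
    move=> a lt_a; apply: disjointWr dA; exact: (bigcup_sup (Ordinal lt_a)).
  by move=> /exists_inPn hF; right; exists B.
elim: s => [|s IH].
  have [|h|[B [BF hB]]] := step 0; first by exists (fun _ => set0); split.
    by left.
  by right; exists 0, B.
case: IH => [/step[h|[B [BF hB]]]|[t [B [ts BF hB]]]]; first by left.
  by right; exists s.+1, B.
by right; exists t, B; split=> //; apply: leqW.
Qed.

(** The matching covers at most s k_j vertices of each V_j, and each lies with [v] in at most k_j D
    / |V_j| members. Since 4 l^2 k_j^2 s <= |V_j|, at most D / 4l members through [v] meet the
    matching, so a heavy [v] has one that avoids it. *)
Lemma heavy_extension V k F v i s : pairwise_disjoint V -> 0 < l ->
  (forall j, 0 < k j) -> (forall j, 4 * l ^ 2 * k j ^ 2 * s <= #|V j|) ->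
  F \subset direct_product V k -> v \in V i ->
  #|direct_product (delete V v) (decrease V k v)| <
    4 * l * #|[set A in F | v \in A]| ->
  has_matching [set A in F | v \notin A] s -> has_matching F s.+1.
Proof.
move=> Vd l_gt0 k_gt0 Vk sF vi; set D := #|direct_product _ _|.
set H := [set A in F | v \in A] => heavy [B [BF Bd]].
have BF' a : a < s -> B a \in F by move/BF; rewrite inE => /andP[].
pose U := \bigcup_(a < s) B a.
have [|] := boolP [exists A in H, [disjoint A & U]].
  case/existsP => A; rewrite inE => /andP[/andP[AF vA] dA].
  apply: (has_matching_cons AF BF' Bd).
  by move=> a lt_a; apply: disjointWr dA; exact: (bigcup_sup (Ordinal lt_a)).
move=> /exists_inPn hitU.
suff : 4 * l ^ 2 * #|H| <= l * D by move: heavy; nia.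
have BD a : a < s -> B a \in direct_product V k by move/BF'/(subsetP sF).
apply: (@hitting_le _ _ V (fun j => s * k j) _ _ U) => //.
- apply/bigcupsP => a _.
  by have /mem_direct_product[] := BD a (ltn_ord a).
- by move=> j; apply: card_matching_union.
move=> j u uU uj; have uv : u != v.
  apply: contraTneq uU => ->; apply/negP => /bigcupP[a _ va].
  by have := BF a (ltn_ord a); rewrite inE va andbF.
have : #|V j| * #|[set A in H | u \in A]| <= k j * D.
  apply: (codegree_le Vd vi (k_gt0 i) uj uv).
    by apply: subset_trans sF; apply/subsetP => A; rewrite !inE => /andP[/andP[]].
  by move=> A; rewrite !inE => /andP[/andP[_ ->]].
move=> h; rewrite -(leq_pmul2l (k_gt0 j)); apply: leq_trans h.
rewrite mulnA leq_mul2r; apply/orP; right; apply: leq_trans (Vk j).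
by rewrite leq_eqVlt; apply/orP; left; apply/eqP; lia.
Qed.

Lemma link_no_matching (w : T -> nat) V F v i s (W : {set T}) : shifted w V F ->
  v \in V i -> W \subset V i -> #|W| = s -> v \notin W ->
  (forall x, x \in W -> w x < w v) -> ~ has_matching F s.+1 ->
  ~ has_matching [set A :\ v | A in F & (v \in A) && [disjoint A & W]] s.+1.
Proof.
move=> shF vi sW cW vW ltW noF [B [BG Bd]]; apply: noF.
(* These s+1 vertices are handed out one to each link set. The link sets avoid both [W] and [v], so
   the enlarged sets stay disjoint. *)
pose L := rcons (enum W) v.
have uL : uniq L by rewrite rcons_uniq mem_enum vW enum_uniq.
have sL : size L = s.+1 by rewrite size_rcons -cardE cW.
have BP a : a < s.+1 ->
    [/\ v \notin B a, v |: B a \in F & [disjoint B a & W]].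
  move=> /BG/imsetP[A]; rewrite inE => /and3P[AF vA dA] ->; split.
  - by rewrite !inE eqxx.
  - by rewrite setD1K.
  - exact: disjointWl (subsetDl _ _) dA.
have nthL a : a < s.+1 -> nth v L a = v \/ nth v L a \in W.
  move=> lt_a; have : nth v L a \in L by rewrite mem_nth ?sL.
  by rewrite mem_rcons inE mem_enum => /orP[/eqP|]; [left|right].
have nthB a b : a < s.+1 -> b < s.+1 -> nth v L a \notin B b.
  move=> lt_a lt_b; have [vB _ dB] := BP b lt_b.
  by case: (nthL a lt_a) => [->//|uW]; rewrite (disjointFl dB).
exists (fun a => nth v L a |: B a); split.
  move=> a lt_a; have [vB vBF dB] := BP a lt_a.
  case: (nthL a lt_a) => [->//|uW].
  have uvB : nth v L a \notin v |: B a.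
    by rewrite !inE negb_or nthB // andbT; apply: contraNneq vW => <-.
  have := shF i _ _ _ (subsetP sW _ uW) vi (ltW _ uW) vBF (setU11 _ _) uvB.
  by rewrite tperm_imset_exchange ?setU11 // setU1K.
have dU1 x (A C : {set T}) : [disjoint x |: A & C] = (x \notin C) && [disjoint A & C].
  by rewrite -setI_eq0 setIUl setU_eq0 !setI_eq0 disjoints1.
move=> a b lt_a lt_b ab; rewrite dU1 !inE negb_or nthB // andbT.
rewrite nth_uniq ?sL // ab /= disjoint_sym dU1 nthB //=.
by rewrite disjoint_sym; apply: Bd.
Qed.

Lemma light_bound (w : T -> nat) V k F s m : injective w ->
  pairwise_disjoint V -> 0 < l -> (forall j, 0 < k j) ->
  (forall j, 4 * l ^ 2 * k j ^ 2 * s <= #|V j|) ->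
  F \subset direct_product V k -> shifted w V F -> ~ has_matching F s.+1 ->
  (forall i v, v \in V i -> 4 * l * #|[set A in F | v \in A]| <=
      #|direct_product (delete V v) (decrease V k v)|) ->
  0 < m -> (forall j, m * k j <= #|V j|) ->
  2 * m * #|F| <= s * #|direct_product V k|.
Proof.
move=> w_inj Vd l_gt0 k_gt0 Vk sF shF noF light m_gt0 mk.
set N := #|direct_product V k|.
have DN i v : v \in V i ->
    #|V i| * #|direct_product (delete V v) (decrease V k v)| = k i * N.
  by move=> vi; apply: card_direct_product_link.
have : forall i, exists W : {set T}, [/\ W \subset V i, #|W| = s &
    forall x y, x \in W -> y \in V i -> y \notin W -> w x < w y].
  move=> i; apply: initial_segment => //; apply: leq_trans (Vk i).
  by rewrite leq_pmull // !muln_gt0 l_gt0 k_gt0.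
case/fin_all_exists => W hW.
pose U1 := \bigcup_(i < l) W i.
have sWU i : W i \subset U1 by apply: bigcup_sup.
pose F1 := [set A in F | ~~ [disjoint A & U1]].
pose F2 := [set A in F | [disjoint A & U1]].
have cF : #|F| = #|F2| + #|F1|.
  rewrite -(cardsID [set A : {set T} | [disjoint A & U1]] F); congr (_ + _).
    by apply: eq_card => A; rewrite !inE.
  by apply: eq_card => A; rewrite !inE andbC.
have sF1 : F1 \subset F by apply/subsetP => A; rewrite inE => /andP[].
have sF2 : F2 \subset F by apply/subsetP => A; rewrite inE => /andP[].
(* The hitting set has s vertices in each part, each of degree at most D / 4l, and D = k_i N / |V_i|
   <= N / m. *)
have h1 : 4 * l * m * #|F1| <= l * (s * N).
  apply: (@hitting_le _ _ V (fun=> s) _ _ U1).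
  - apply/bigcupsP => i _; apply: subset_trans (bigcup_sup i _) => //.
    by have [] := hW i.
  - move=> i; have [sW <- _] := hW i.
    apply/subset_leq_card/subsetP => x; rewrite inE => /andP[/bigcupP[j _ xj] xi].
    have [sWj _ _] := hW j.
    by rewrite (pairwise_disjoint_uniq Vd xi (subsetP sWj _ xj)).
  - by move=> A; rewrite inE => /andP[].
  move=> i u _ ui; have := light i u ui; have := DN i u ui; have := mk i.
  have : #|[set A in F1 | u \in A]| <= #|[set A in F | u \in A]|.
    by apply/subset_leq_card/subsetP => A; rewrite !inE => /andP[/andP[->]].
  move: (k_gt0 i) #|[set A in F1 | u \in A]| #|[set A in F | u \in A]|.
  move: (k i) #|V i| #|direct_product (delete _ _) _| => K n D K0 d1 d le_d le_mn E le_D.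
  have le_mD : m * D <= N.
    by rewrite -(leq_pmul2l K0) -E mulnA leq_mul2r [K * m]mulnC le_mn orbT.
  apply: (@leq_trans (4 * l * m * s * d)); first by rewrite leq_mul2l le_d orbT.
  apply: (@leq_trans (s * (m * (4 * l * d)))); first by lia.
  by rewrite leq_mul2l (leq_trans _ le_mD) ?orbT // leq_mul2l le_D orbT.
have [t [B [ts BF2 hitB]]] : exists t (B : nat -> {set T}), [/\ t <= s,
    forall a, a < t -> B a \in F2 &
    forall A, A \in F2 -> ~~ [disjoint A & \bigcup_(a < t) B a]].
  by apply: hitting_union => h; apply: noF; apply: has_matching_sub h.
have BD a : a < t -> B a \in direct_product V k.
  by move/BF2/(subsetP sF2)/(subsetP sF).
(* Here a part holds at most s k_j hitting vertices, each of degree at most s D / m with D = k_j N /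
   |V_j|; the size hypothesis bounds their total by s N / (4 l^2 m). *)
have h2 : 4 * l ^ 2 * m * #|F2| <= l * (s * N).
  apply: (@hitting_le _ _ V (fun j => s * k j) _ _ (\bigcup_(a < t) B a)) => //.
  - apply/bigcupsP => a _.
    by have /mem_direct_product[] := BD a (ltn_ord a).
  - move=> j; apply: (@leq_trans (t * k j)); last by rewrite leq_mul2r ts orbT.
    exact: card_matching_union.
  move=> i v /bigcupP[a _ va] vi; have [sW cW ltW] := hW i.
  have vW : v \notin W i.
    apply/negP => /(subsetP (sWU i)) vU.
    have := BF2 a (ltn_ord a); rewrite inE => /andP[_ /disjointFr/(_ va)].
    by rewrite vU.
  have le_d : m * #|[set A in F2 | v \in A]| <=
              s * #|direct_product (delete V v) (decrease V k v)|.
    have vH A : A \in [set A in F2 | v \in A] -> v \in A.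
      by rewrite inE => /andP[].
    rewrite -(card_in_imset (link_injective vH)).
    apply: katona_averaging.
    - exact: pairwise_disjoint_delete.
    (* In the part of [v] one vertex is lost, but the m blocks need m >= 1 fewer. *)
    - move=> j; rewrite card_delete /decrease; have := mk j; have := k_gt0 j.
      by case: (v \in V j) => /=; nia.
    - apply/subsetP => _ /imsetP[A AH ->]; apply: direct_product_link.
        exact: vH.
      by move: AH; rewrite inE => /andP[/(subsetP sF2)/(subsetP sF)].
    have := link_no_matching shF vi sW cW vW (fun x xW => ltW x v xW vi vW) noF.
    move=> no h; apply: no; apply: has_matching_sub h.
    apply/subsetP => _ /imsetP[A AH ->]; apply/imsetP; exists A => //.
    move: AH; rewrite !inE => /andP[/andP[-> dA] ->].
    exact: disjointWr (sWU i) dA.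
  move: le_d; have := DN i v vi; have := Vk i; have := k_gt0 i.
  move: (k i) #|V i| #|direct_product (delete _ _) _| #|[set A in F2 | v \in A]|.
  move=> K n D d K0 le_n E le_d.
  have le_N : 4 * l ^ 2 * s * K * D <= N.
    rewrite -(leq_pmul2l K0) -E mulnA leq_mul2r; apply/orP; right.
    by apply: leq_trans le_n; rewrite leq_eqVlt; apply/orP; left; apply/eqP; lia.
  apply: (@leq_trans (4 * l ^ 2 * (s * K) * (m * d))); first by lia.
  apply: (@leq_trans (4 * l ^ 2 * (s * K) * (s * D))).
    by rewrite leq_mul2l le_d orbT.
  apply: (@leq_trans (s * (4 * l ^ 2 * s * K * D))); first by lia.
  by rewrite leq_mul2l le_N orbT.
have {}h1 : 4 * m * #|F1| <= s * N.
  by rewrite -(leq_pmul2l l_gt0); apply: leq_trans h1; lia.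
have {}h2 : 4 * m * #|F2| <= s * N.
  rewrite -(leq_pmul2l l_gt0); apply: leq_trans h2.
  have -> : l * (4 * m * #|F2|) = 4 * m * #|F2| * l by lia.
  apply: (@leq_trans (4 * m * #|F2| * l ^ 2)); last by lia.
  by rewrite leq_mul2l -mulnn leq_pmulr ?orbT.
by rewrite cF; lia.
Qed.

End MainInduction.

(** * The bound *)

(** The bound without subtraction and with a witness for the maximum, which makes it additive under
    splitting at a vertex. In the induction [k] stays fixed, since members avoiding a vertex keep
    their trace sizes. *)
Lemma no_matching_bound (T : finType) (l s : nat) (V : 'I_l -> {set T})
    (k : 'I_l -> nat) (F : {set {set T}}) :
  0 < l -> (forall i, 0 < k i) -> pairwise_disjoint V ->
  (forall i, 4 * l ^ 2 * k i ^ 2 * s <= #|V i|) ->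
  F \subset direct_product V k -> ~ has_matching F s.+1 ->
  exists i, #|F| + 'C(#|V i| - s, k i) * \prod_(j < l | j != i) 'C(#|V j|, k j)
            <= #|direct_product V k|.
Proof.
move=> l_gt0 k_gt0; elim: s V F => [|s IH] V F Vd Vk sF noF.
  exists (Ordinal l_gt0); suff -> : F = set0.
    by rewrite cards0 subn0 card_direct_product // [X in _ <= X](bigD1 (Ordinal l_gt0)).
  apply/setP => A; rewrite inE; apply/negP => AF; apply: noF.
  by exists (fun=> A); split=> // a b; rewrite !ltnS !leqn0 => /eqP-> /eqP->.
pose w (x : T) : nat := enum_rank x.
have w_inj : injective w by move=> x y /val_inj/enum_rank_inj.
have [F1 [sF1 <- mF1 shF1]] := shifted_exists w Vd sF.
have {}noF : ~ has_matching F1 s.+2 by move/mF1.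
move: F1 sF1 shF1 noF {F sF mF1} => F sF shF noF.
have c_gt0 i : 0 < 4 * l ^ 2 * k i ^ 2 by rewrite !muln_gt0 l_gt0 k_gt0.
have Vs i : s < #|V i| by apply: leq_trans (Vk i); rewrite leq_pmull.
pose D v := #|direct_product (delete V v) (decrease V k v)|.
pose heavy i v := (v \in V i) && (D v < 4 * l * #|[set A in F | v \in A]|).
have [/existsP[i /existsP[v /andP[vi vheavy]]]|no_heavy] :=
    boolP [exists i, exists v, heavy i v].
  pose F0 := [set A in F | v \notin A].
  have cF : #|F| = #|[set A in F | v \in A]| + #|F0|.
    rewrite -(cardsID [set A : {set T} | v \in A] F).
    by congr (_ + _); apply: eq_card => A; rewrite !inE // andbC.
  have le_D : #|[set A in F | v \in A]| <= D v.
    apply: card_link_le => [|A]; last by rewrite inE => /andP[].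
    by apply: subset_trans sF; apply/subsetP => A; rewrite inE => /andP[].
  have split_N := card_direct_product_split Vd vi (k_gt0 i).
  have [|||j IHj] := IH (delete V v) F0 (pairwise_disjoint_delete v Vd).
  (* Lowering s+1 to s weakens the size requirement by at least 1, which pays for the deleted
     vertex. *)
  - move=> j; have := Vk j; have := c_gt0 j; rewrite card_delete.
    by move: (4 * _ * _) => c; case: (v \in V j) => /=; lia.
  - apply/subsetP => A; rewrite inE => /andP[/(subsetP sF) AD vA].
    by rewrite -direct_product_delete AD.
  - by move=> h; apply: noF; apply: heavy_extension Vd _ _ _ sF vi vheavy h.
  have card_del x : x != i -> #|delete V v x| = #|V x|.
    move=> xi; rewrite card_delete; case: (boolP (v \in V x)) => [vx|].
      by rewrite (pairwise_disjoint_uniq Vd vi vx) eqxx in xi.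
    by rewrite subn0.
  have card_deli : #|delete V v i| = #|V i|.-1 by rewrite card_delete vi subn1.
  have [ji|ji] := eqVneq j i.
    (* The deleted vertex and the s further ones lie in one part, so they count together as s+1. *)
    exists i; move: IHj; rewrite ji card_deli.
    have -> : #|V i|.-1 - s = #|V i| - s.+1 by lia.
    under eq_bigr do rewrite card_del //.
    by move=> IHi; rewrite cF split_N -addnA; apply: leq_add le_D IHi.
  pose Q := \prod_(x < l | (x != i) && (x != j)) 'C(#|V x|, k x).
  have Pj : \prod_(x < l | x != j) 'C(#|V x|, k x) = 'C(#|V i|, k i) * Q.
    rewrite (bigD1 i) 1?eq_sym //=; congr (_ * _).
    by apply: eq_bigl => x; rewrite andbC.
  have Pi : \prod_(x < l | x != i) 'C(#|V x|, k x) = 'C(#|V j|, k j) * Q.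
    by rewrite (bigD1 j).
  have P'j : \prod_(x < l | x != j) 'C(#|delete V v x|, k x) = 'C(#|V i|.-1, k i) * Q.
    rewrite (bigD1 i) 1?eq_sym //= card_deli; congr (_ * _).
    apply: eq_big => [x|x /andP[_ xi]]; first by rewrite andbC.
    by rewrite card_del.
  rewrite P'j card_del // mulnA in IHj.
  (* The hypothesis leaves out one vertex of V_i and s of V_j; all s+1 are now charged to a single
     part. *)
  have [h|h] := bin_exchange (k i) (k j) (Vs i) (Vs j); [exists j | exists i].
    rewrite Pj mulnA cF split_N -addnA; apply: leq_add le_D (leq_trans _ IHj).
    by rewrite leq_add2l leq_mul2r h orbT.
  rewrite Pi mulnA [_ * 'C(#|V j|, _)]mulnC cF split_N -addnA.
  apply: leq_add le_D (leq_trans _ IHj).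
  by rewrite leq_add2l leq_mul2r h orbT.
(* Minimality makes m disjoint blocks fit in every part, while |V_i| < (m+1) k_i keeps the averaging
   bound below the target at this [i]. *)
case: (arg_minnP (P := predT) (fun i => #|V i| %/ k i) (erefl : predT (Ordinal l_gt0))).
move=> i _ i_min; exists i; set m := #|V i| %/ k i in i_min.
have ki_gt0 := k_gt0 i.
have le_c : 4 * (s.+1 * k i) <= #|V i|.
  apply: leq_trans (Vk i); rewrite mulnA mulnAC leq_mul2r; apply/orP; right.
  rewrite -mulnA leq_mul2l /=; apply: (@leq_trans (k i ^ 2)).
    by rewrite -mulnn leq_pmulr.
  by rewrite leq_pmull // muln_gt0 l_gt0.
have m2 : 2 <= m.
  by rewrite /m leq_divRL //; apply: leq_trans le_c; nia.
have mk j : m * k j <= #|V j| by rewrite -leq_divRL //; apply: i_min.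
have light : 2 * m * #|F| <= s.+1 * #|direct_product V k|.
  apply: light_bound w_inj Vd l_gt0 k_gt0 Vk sF shF noF _ _ mk; last by lia.
  move=> j v vj; rewrite leqNgt; apply: contraNN no_heavy => h.
  by apply/existsP; exists j; apply/existsP; exists v; rewrite /heavy vj.
have := bin_missing_ge m2 ki_gt0 (ltn_ceil _ ki_gt0) le_c.
rewrite card_direct_product // (bigD1 i) //= in light *.
move: light; move: (\prod_(j | _) _) 'C(_ - _, _) 'C(_, _) => P x y light xy.
have m_gt0 : 0 < 2 * m by lia.
rewrite -(leq_pmul2l m_gt0) mulnDr.
apply: leq_trans (leq_add light (leqnn _)) _.
have -> : s.+1 * (y * P) + 2 * m * (x * P) = (s.+1 * y + 2 * m * x) * P by lia.
by rewrite mulnA leq_mul2r xy orbT.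
Qed.

(** * Passage to the matching number *)

Lemma has_matching_leq_matching_number (T : finType) (F : {set {set T}}) t :
  set0 \notin F -> has_matching F t -> t <= matching_number F.
Proof.
move=> F0 [B [BF Bd]]; pose M := [set B (a : 'I_t) | a in 'I_t].
(* Disjoint nonempty sets are distinct, so the indexed matching yields a set of exactly t
   members. *)
have B_inj : injective (fun a : 'I_t => B a).
  move=> a b E; apply/val_inj/eqP; apply: contraNT F0 => ab.
  have := Bd a b (ltn_ord a) (ltn_ord b) ab.
  by rewrite -E -setI_eq0 setIid => /eqP <-; apply: BF.
have -> : t = #|M| by rewrite card_imset // card_ord.
rewrite /matching_number; apply: (bigmax_sup M) => //; apply/andP; split.
  by apply/subsetP => _ /imsetP[a _ ->]; apply: BF.
apply/trivIsetP => _ _ /imsetP[a _ ->] /imsetP[b _ ->] ab.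
by apply: Bd => //; apply: contraNneq ab => ->.
Qed.

Theorem theorem1p4 (l s : nat) (n k : 'I_l -> nat)
    (l_gt0 : 0 < l) (s_gt0 : 0 < s)
    (n_gt0 : forall i : 'I_l, 0 < n i)
    (k_gt0 : forall i : 'I_l, 0 < k i)
    (n_ge : forall i : 'I_l, 4 * l ^ 2 * k i ^ 2 * s <= n i)
    (T : finType) (V : 'I_l -> {set T})
    (V_disj : forall i j : 'I_l, i != j -> [disjoint V i & V j])
    (V_card : forall i : 'I_l, #|V i| = n i)
    (F : {set {set T}})
    (F_sub : F \subset direct_product V k)
    (F_nu : matching_number F <= s) :
  #|F| <= \max_(i < l)
            (('C(n i, k i) - 'C(n i - s, k i))
             * \prod_(j < l | j != i) 'C(n j, k j)).
Proof.
(* There is a part, and every member meets it in a positive number of vertices. *)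
have F0 : set0 \notin F.
  apply/negP => /(subsetP F_sub)/mem_direct_product[_ /(_ (Ordinal l_gt0))].
  by move=> E; have := k_gt0 (Ordinal l_gt0); rewrite -E set0I cards0.
have noF : ~ has_matching F s.+1.
  by move/(has_matching_leq_matching_number F0); rewrite leqNgt ltnS F_nu.
have n_ge' i : 4 * l ^ 2 * k i ^ 2 * s <= #|V i| by rewrite V_card.
have [i] := no_matching_bound l_gt0 k_gt0 V_disj n_ge' F_sub noF.
rewrite card_direct_product // (bigD1 (P := predT) i) //= V_card.
under eq_bigr do rewrite V_card.
move=> le_F; apply: (bigmax_sup i) => //.
by rewrite mulnBl leq_subRL; lia.
Qed.
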